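(* Let $q>1$, $B>0$, $\mathcal Y=[-B,B]$ and consider the $L_q$-loss $L[(x,y),g]=|y-g(x)|^q$. Then for every $\eta>0$ with $$\eta\le\frac{q-1}{qB^q}\,\min(1,2^{2-q}),$$ the following holds: for every probability distribution $\rho$ on $\mathcal G$ there exists $g_\rho:\mathcal X\to\mathcal Y$ such that for all $x\in\mathcal X$ and $y\in\mathcal Y$, $$L[(x,y),g_\rho]\le-\frac1\eta\log\mathbb E_{g\sim\rho}\,e^{-\eta L[(x,y),g]}.$$
   Context: $\mathcal X$ is the input space, $\mathcal Y$ the output space; $\mathcal G$ is a (measurable) set of prediction functions $g:\mathcal X\to\mathcal Y$, and all quantities are implicitly assumed measurable. *)

(* Defs.v *)
From HB Require Import structures.
From mathcomp Require Import all_boot all_order all_algebra.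
From mathcomp Require Import all_classical all_reals all_analysis.

Set Implicit Arguments.
Unset Strict Implicit.
Unset Printing Implicit Defensive.

Import Order.TTheory GRing.Theory Num.Theory.
Import numFieldNormedType.Exports.

Local Open Scope classical_set_scope.
Local Open Scope ring_scope.

Section Prediction.
Context {R : realType} {dX : measure_display} {X : measurableType dX}.

Definition outputs (B : R) : set R := [set` `[- B, B]].

Definition prediction_functions (B : R) : set (X -> R) :=
  [set g | measurable_fun setT g /\ forall x, outputs B (g x)].

Definition Lq_loss (q : R) (z : X * R) (g : X -> R) : R :=
  `|z.2 - g z.1| `^ q.

(* Prediction functions carry the sigma-algebra <<s S>> generated by S.  Taking
   for S the measurable subsets of a set G, this covers every sigma-algebra
   on G: G belongs to <<s S>> and the trace of <<s S>> on G is S. *)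
Definition jointly_measurable (S : set (set (X -> R))) (G : set (X -> R)) :=
  measurable_fun ([set: X] `*` (G : set (g_sigma_algebraType S)))
    (fun p : X * g_sigma_algebraType S => p.2 p.1).

(* - (1 / eta) log E_{g ~ rho} exp (- eta L[z, g]), for rho supported by G *)
Definition mix_loss (S : set (set (X -> R))) (G : set (X -> R))
    (rho : probability (g_sigma_algebraType S) R) (eta : R)
    (L : X * R -> (X -> R) -> R) (z : X * R) : R :=
  - eta^-1 * ln (\int[rho]_(g in G) expR (- (eta * L z g))).

End Prediction.

(* Main.v *)
(** Fix [x] and let [F y] be the right-hand side.  The value [p] of the
    predictor at [x] must lie in every interval
    [[y - F y `^ q^-1, y + F y `^ q^-1]], so by Helly's theorem on the line it
    suffices that these intervals meet pairwise, i.e. that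
    [z - y <= F y `^ q^-1 + F z `^ q^-1].  If this failed, there would be
    [t, s > 0] with [t + s = z - y], [F y < t `^ q] and [F z < s `^ q].  This is
    excluded by integrating over [g] the pointwise inequality
    [s^(q-1) e^(eta (t^q - |v|^q)) + t^(q-1) e^(eta (s^q - |t + s - v|^q))
     <= s^(q-1) + t^(q-1)] at [v = g x - y].  The derivative of its left-hand
    side changes sign only at [v = t], because [L v - L (t + s - v)] is monotone
    for [L v = (q - 1) ln v - eta v^q]; this is where the bound on [eta] enters.
    Taking for [p] the supremum of the left endpoints over a countable dense set
    of [y] makes the predictor measurable, and [F] being Lipschitz gives the
    remaining [y]. *)
Require Import Defs.
From HB Require Import structures.
From mathcomp Require Import all_boot all_order all_algebra.
From mathcomp Require Import all_classical all_reals all_analysis.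
From mathcomp Require Import measurable_realfun ring lra.

Set Implicit Arguments.
Unset Strict Implicit.
Unset Printing Implicit Defensive.

Import Order.TTheory GRing.Theory Num.Theory.
Import numFieldNormedType.Exports.

Local Open Scope classical_set_scope.
Local Open Scope ring_scope.

(** * Tangent, Lipschitz and two-point inequalities for real powers *)

Section PowerInequalities.
Context {R : realType}.
Implicit Types q r x y v w : R.

(** Young's inequality for the product of x^r and 1, with conjugate exponents [r^-1] and
    [(1 - r)^-1]. *)
Lemma powR_le_tangent1 r x : 0 < r <= 1 -> 0 <= x -> x `^ r <= 1 + r * (x - 1).
Proof.
move=> /andP[r0]; rewrite le_eqVlt => /predU1P[->|r1] x0.
  by rewrite powRr1//; lra.
have r'0 : 0 < 1 - r by lra.
have := @conjugate_powR R (x `^ r) 1 r^-1 (1 - r)^-1 (powR_ge0 _ _) ler01.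
rewrite !invr_gt0 !invrK r0 r'0 -powRrM divff ?gt_eqF// powRr1// powR1.
by move=> /(_ isT isT); rewrite mulr1 => H; apply: le_trans (H _) _; lra.
Qed.

(** The preceding bound with exponent [q^-1] at the point x^q, solved for x^q. *)
Lemma powR_ge_tangent1 q x : 1 <= q -> 0 <= x -> 1 + q * (x - 1) <= x `^ q.
Proof.
move=> q1 x0; have q0 : 0 < q by lra.
have := @powR_le_tangent1 q^-1 (x `^ q).
rewrite invr_gt0 q0 invf_le1// q1 powR_ge0 -powRrM divff ?gt_eqF// powRr1//.
move=> /(_ isT isT) /(ler_wpM2l (ltW q0)).
by rewrite mulrDr mulrA divff ?gt_eqF// mul1r; lra.
Qed.

(** For y <= x, the tangent bound at y / x, multiplied by x^q, gives x^q - y^q <= q x^(q-1) (x -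
    y). *)
Lemma powR_lipschitz q (M : R) x y : 1 < q -> 0 <= x <= M -> 0 <= y <= M ->
  `|x `^ q - y `^ q| <= q * M `^ (q - 1) * `|x - y|.
Proof.
move=> q1; wlog yx : x y / y <= x => [H xM yM|/andP[x0 xM] /andP[y0 _]].
  by have [/H|/ltW/H] := leP y x; [|rewrite distrC [`|x - y|]distrC]; apply.
have q0 : 0 < q by lra.
rewrite !ger0_norm ?subr_ge0 ?ge0_ler_powR ?nnegrE ?(ltW q0)//.
have [x00|xN0] := eqVneq x 0.
  by have -> : y = x; [lra|rewrite !subrr mulr0].
have {}x0 : 0 < x by rewrite lt_neqAle eq_sym xN0.
have := @powR_ge_tangent1 q (y / x) (ltW q1) (divr_ge0 y0 (ltW x0)).
rewrite -(ler_pM2r (powR_gt0 q x0)) -powRM ?divr_ge0 ?(ltW x0)// divfK// => H.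
have E : x `^ q = x * x `^ (q - 1).
  by rewrite mulr_powRB1// ltW.
apply: (@le_trans _ _ (q * x `^ (q - 1) * (x - y))).
  apply: le_trans (_ : x `^ q * (q * (1 - y / x)) <= _).
    by move: H; lra.
  by rewrite E le_eqVlt; apply/orP; left; apply/eqP; field.
rewrite ler_wpM2r ?subr_ge0// ler_wpM2l ?(ltW q0)// ge0_ler_powR ?nnegrE//.
- lra.
- lra.
- lra.
Qed.

Lemma continuous_norm_powR q : 1 < q -> continuous (fun x => `|x| `^ q).
Proof.
move=> q1 x; pose K := q * (`|x| + 1) `^ (q - 1).
have x10 : 0 < `|x| + 1 by have := normr_ge0 x; lra.
have K0 : 0 < K by rewrite mulr_gt0 ?powR_gt0//; lra.
apply/cvgrPdist_le => e e0; near=> y.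
have yx : `|x - y| <= 1.
  by near: y; apply: cvgr_dist_le => //; exact: cvg_id.
have yxe : `|x - y| <= e / K.
  by near: y; apply: cvgr_dist_le; [exact: cvg_id|exact: divr_gt0].
apply: le_trans (@powR_lipschitz q (`|x| + 1) _ _ q1 _ _) _.
- by rewrite normr_ge0/=; lra.
- rewrite normr_ge0/=; have := ler_normB x (x - y); rewrite subKr; lra.
- rewrite -/K mulrC -ler_pdivlMr//; apply: le_trans yxe.
  exact: ler_dist_dist.
Unshelve. all: by end_near. Qed.

(** With m the midpoint, v w <= m^2 and m <= B. Each entry of the minimum serves one range of q: for
    q <= 2, concavity bounds the sum of powers by 2 m^(q-1); for q >= 2, superadditivity bounds it
    by (2m)^(q-1), and the factor 2^(2-q) brings this back to 2 m^(q-1). *)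
Lemma powR_pair_bound q (B : R) v w : 1 < q -> 0 < v -> 0 < w ->
    v + w <= 2 * B ->
  Num.min 1 (2 `^ (2 - q)) * (v * w * (v `^ (q - 1) + w `^ (q - 1)))
    <= (v + w) * B `^ q.
Proof.
move=> q1 v0 w0 vwB; set m := (v + w) / 2.
have m0 : 0 < m by rewrite /m; lra.
have mB : m `^ q <= B `^ q by rewrite ge0_ler_powR ?nnegrE//; rewrite /m; lra.
have vwm : v * w <= m * m by rewrite /m -subr_ge0; have := sqr_ge0 (v - w); nra.
have mq : m `^ q = m * m `^ (q - 1).
  by rewrite mulr_powRB1 ?(ltW m0)//; lra.
have -> : v + w = 2 * m by rewrite /m; lra.
have vw0 : 0 < v * w by exact: mulr_gt0.
apply: (@le_trans _ _ (2 * m * m `^ q)); last by rewrite ler_wpM2l//; lra.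
have P0 : 0 < m `^ (q - 1) by exact: powR_gt0.
have S0 : 0 < v `^ (q - 1) + w `^ (q - 1) by rewrite addr_gt0// powR_gt0.
have [q2|/ltW q2] := leP q 2.
  have S : v `^ (q - 1) + w `^ (q - 1) <= 2 * m `^ (q - 1).
    (* Tangent at m; when the bounds for v and w are added, the linear terms cancel since v + w =
       2m. *)
    have H (z : R) : 0 < z ->
        z `^ (q - 1) <= (1 + (q - 1) * (z / m - 1)) * m `^ (q - 1).
      move=> z0; have zm : z = z / m * m by field; rewrite gt_eqF.
      have zm0 : 0 <= z / m by rewrite divr_ge0// ltW.
      rewrite {1}zm powRM ?(ltW m0)// ler_wpM2r ?powR_ge0//.
      by rewrite powR_le_tangent1//; lra.
    apply: le_trans (lerD (H v v0) (H w w0)) _.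
    rewrite -mulrDl ler_wpM2r ?(ltW P0)// /m le_eqVlt.
    apply/orP; left; apply/eqP.
    by field; rewrite gt_eqF// addr_gt0.
  apply: (@le_trans _ _ (1 * (m * m * (2 * m `^ (q - 1))))).
    apply: ler_pM => //.
    - by rewrite mulr_ge0// ltW.
    - by apply: ler_pM => //; exact: ltW.
  by rewrite mq le_eqVlt; apply/orP; left; apply/eqP; ring.
have S : v `^ (q - 1) + w `^ (q - 1) <= (2 * m) `^ (q - 1).
  have H (z : R) : 0 < z -> z <= 2 * m ->
      z `^ (q - 1) <= z * (2 * m) `^ (q - 2).
    move=> z0 zm; have -> : q - 2 = q - 1 - 1 by lra.
    rewrite -(mulr_powRB1 (ltW z0)); last lra.
    by rewrite ler_wpM2l ?(ltW z0)// ge0_ler_powR ?nnegrE//; lra.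
  apply: (@le_trans _ _ (2 * m * (2 * m) `^ (q - 2))).
    have := H v v0; have := H w w0; rewrite /m; lra.
  have -> : q - 2 = q - 1 - 1 by lra.
  by rewrite mulr_powRB1//; lra.
apply: (@le_trans _ _ (2 `^ (2 - q) * (m * m * (2 * m) `^ (q - 1)))).
  apply: ler_pM => //.
  - by rewrite mulr_ge0// ltW.
  - by rewrite ge_min lexx orbT.
  - by apply: ler_pM => //; exact: ltW.
rewrite powRM//; last exact: ltW.
have E : 2 `^ (2 - q) * 2 `^ (q - 1) = 2 :> R.
  rewrite -powRD ?pnatr_eq0 ?implybT//.
  by rewrite (_ : 2 - q + (q - 1) = 1) ?powRr1//; lra.
have -> : 2 `^ (2 - q) * (m * m * (2 `^ (q - 1) * m `^ (q - 1)))
  = 2 `^ (2 - q) * 2 `^ (q - 1) * m * (m * m `^ (q - 1)) by ring.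
by rewrite E -mq.
Qed.
(** The form in which the bound on [eta] enters the calculus: it gives the sign of a derivative in
    [slope_diff_ndecr]. Multiplying by v w reduces it to [powR_pair_bound]. *)
Lemma powR_pair_rate q (B eta : R) v w : 1 < q -> 0 < B ->
    eta <= (q - 1) / (q * B `^ q) * Num.min 1 (2 `^ (2 - q)) ->
    0 < v -> 0 < w -> v + w <= 2 * B ->
  eta * q * (v `^ (q - 1) + w `^ (q - 1)) <= (q - 1) * (v^-1 + w^-1).
Proof.
move=> q_gt1 B_gt0 eta_le v0 w0 vwB; have q0 := lt_trans ltr01 q_gt1.
have vw0 : 0 < v * w by exact: mulr_gt0.
have Bq0 : 0 < B `^ q by exact: powR_gt0.
have S0 : 0 < v `^ (q - 1) + w `^ (q - 1) by rewrite addr_gt0// powR_gt0.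
rewrite -(ler_pM2l vw0).
have -> : v * w * ((q - 1) * (v^-1 + w^-1)) = (q - 1) * (v + w).
  by field; rewrite !gt_eqF.
have := powR_pair_bound q_gt1 v0 w0 vwB; set c := Num.min _ _ => H.
have r0 : 0 < (q - 1) / B `^ q by rewrite divr_gt0// subr_gt0.
move: (ler_wpM2l (ltW r0) H).
have -> : (q - 1) / B `^ q * ((v + w) * B `^ q) = (q - 1) * (v + w).
  by field; rewrite gt_eqF.
apply: le_trans.
have P0 : 0 < q * (v * w * (v `^ (q - 1) + w `^ (q - 1))) by rewrite !mulr_gt0.
have := ler_wpM2r (ltW P0) eta_le; rewrite -/c.
have -> : (q - 1) / (q * B `^ q) * c *
    (q * (v * w * (v `^ (q - 1) + w `^ (q - 1)))) =
  (q - 1) / B `^ q * (c * (v * w * (v `^ (q - 1) + w `^ (q - 1)))).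
  by field; rewrite !gt_eqF.
by apply: le_trans; rewrite le_eqVlt; apply/orP; left; apply/eqP; ring.
Qed.

End PowerInequalities.

(** * The pointwise exponential inequality *)

Section KeyInequality.
Context {R : realType}.
Variables (q B eta : R).
Hypotheses (q_gt1 : 1 < q) (eta_gt0 : 0 < eta).
Hypothesis rate_le : forall v w : R, 0 < v -> 0 < w -> v + w <= 2 * B ->
  eta * q * (v `^ (q - 1) + w `^ (q - 1)) <= (q - 1) * (v^-1 + w^-1).
Implicit Types s t u v w : R.

(** Logarithm of v^(q-1) e^(-eta v^q), which up to the factor eta q is the absolute derivative of
    e^(-eta v^q). *)
Let slope v : R := (q - 1) * ln v - eta * v `^ q.

Let is_derive_slope v : 0 < v ->
  is_derive v 1 slope ((q - 1) * v^-1 - eta * (q * v `^ (q - 1))).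
Proof.
move=> v0; have H1 := is_derive1_ln v0; have H2 := is_derive1_powR q v0.
rewrite /slope; apply: is_derive_eq.
by rewrite /GRing.scale/=.
Qed.

Let is_derive_slopeB (D v : R) : v < D ->
  is_derive v 1 (fun v => slope (D - v))
    (- ((q - 1) * (D - v)^-1 - eta * (q * (D - v) `^ (q - 1)))).
Proof.
move=> vD; have Dv0 : 0 < D - v by rewrite subr_gt0.
have H := is_derive_slope Dv0.
have H2 : is_derive v 1 (fun v => D - v) (-1 : R).
  by apply: is_derive_eq; rewrite add0r mul1r.
have := @is_derive1_comp _ slope (fun v => D - v) v _ _ H H2.
by rewrite mulrN1.
Qed.

(** By [rate_le], [slope u - slope (t + s - u)] has a nonnegative derivative on ]0, t + s[; its
    value at u = t is the right-hand side. *)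
Let slope_diff_ndecr t s v : 0 < v -> v <= t -> 0 < s -> t + s <= 2 * B ->
  slope v - slope (t + s - v) <= slope t - slope s.
Proof.
move=> v0 vt s0 tsB; set D := t + s.
have dphi u : u \in `]0, D[ ->
    is_derive u 1 (fun u => slope u - slope (D - u))
    ((q - 1) * u^-1 - eta * (q * u `^ (q - 1)) +
     ((q - 1) * (D - u)^-1 - eta * (q * (D - u) `^ (q - 1)))).
  rewrite in_itv/= => /andP[u0 uD].
  have H1 := is_derive_slope u0; have H2 := is_derive_slopeB uD.
  by apply: is_derive_eq; rewrite opprK.
have := @ger0_derive1_le_oo R (fun u => slope u - slope (D - u)) 0 D _ _ _ v t.
rewrite (_ : D - t = s); last by rewrite /D; lra.
apply.
- by move=> u /dphi[].
- move=> u uD; rewrite derive1E; have [_ ->] := dphi u uD.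
  move: uD; rewrite in_itv/= => /andP[u0 uD].
  have := @rate_le u (D - u) u0; rewrite subr_gt0 uD subrKC => /(_ isT tsB).
  lra.
- move=> u /[!inE] /= uD; have [+ _] := dphi u uD.
  by move=> /derivable1_diffP/differentiable_continuous.
- rewrite in_itv/= v0/= /D; lra.
- rewrite in_itv/= /D; apply/andP; split; lra.
- exact: vt.
Qed.

Let separation t s v : R :=
  s `^ (q - 1) * expR (eta * (t `^ q - v `^ q)) +
  t `^ (q - 1) * expR (eta * (s `^ q - (t + s - v) `^ q)).

Let is_derive_separation t s v : 0 < v -> v < t + s ->
  is_derive v 1 (separation t s)
    (eta * q * (t `^ (q - 1) * ((t + s - v) `^ (q - 1) *
                  expR (eta * (s `^ q - (t + s - v) `^ q))) -
                s `^ (q - 1) * (v `^ (q - 1) *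
                  expR (eta * (t `^ q - v `^ q))))).
Proof.
move=> v0 vD; set D := t + s; have Dv0 : 0 < D - v by rewrite subr_gt0.
have H1 := is_derive1_powR q v0.
have H2 : is_derive v 1 (fun v => (D - v) `^ q) (- (q * (D - v) `^ (q - 1))).
  have dD : is_derive v 1 (fun v => D - v) (-1 : R).
    by apply: is_derive_eq; rewrite add0r mul1r.
  have := @is_derive1_comp R (fun u => u `^ q) (fun v => D - v) v _ _
    (is_derive1_powR q Dv0) dD.
  by rewrite mulrN1.
have dexp (c a df : R) (f : R -> R) : is_derive v 1 f df ->
    is_derive v 1 (fun u => c * expR (eta * (a - f u)))
      (c * (expR (eta * (a - f v)) * (eta * - df))).
  move=> dF; have dG : is_derive v 1 (fun u => eta * (a - f u)) (eta * - df).
    by apply: is_derive_eq; rewrite /GRing.scale/=; ring.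
  have dE := @is_derive1_comp _ expR _ v _ _ (is_derive_expR _) dG.
  by apply: is_derive_eq.
have {}H1 := dexp (s `^ (q - 1)) (t `^ q) _ _ H1.
have {}H2 := dexp (t `^ (q - 1)) (s `^ q) _ _ H2.
have H := is_deriveD H1 H2.
by apply: is_derive_eq H _; rewrite /D; ring.
Qed.

(** [separation t s] is nondecreasing on [0, t], and its value at t is the right-hand side. *)
Let separation_half t s v : 0 < t -> 0 < s -> t + s <= 2 * B ->
  0 <= v <= t -> separation t s v <= s `^ (q - 1) + t `^ (q - 1).
Proof.
move=> t0 s0 tsB /andP[v0 vt].
have -> : s `^ (q - 1) + t `^ (q - 1) = separation t s t.
  by rewrite /separation addrAC !subrr add0r subrr mulr0 expR0 !mulr1.
have cont : {within `[0, t], continuous (separation t s)}.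
  (* The derivative is computed only for v > 0; continuity up to the endpoint 0 comes from this
     everywhere continuous function, equal to [separation t s] on [0, t]. *)
  pose f v : R := s `^ (q - 1) * expR (eta * (t `^ q - `|v| `^ q)) +
    t `^ (q - 1) * expR (eta * (s `^ q - `|t + s - v| `^ q)).
  apply: (@subspace_eq_continuous _ _ _ f).
    move=> u; rewrite inE/= in_itv/= => /andP[u0 ut].
    by rewrite /f /separation !ger0_norm//; lra.
  apply: continuous_subspaceT => u.
  have cn := continuous_norm_powR q_gt1.
  have cexp (c a : R) (g : R -> R) : {for u, continuous g} ->
      {for u, continuous (fun u => c * expR (eta * (a - `|g u| `^ q)))}.
    move=> cg; apply: cvgM; first exact: cvg_cst.
    apply: (@continuous_comp _ _ _ (fun u => eta * (a - `|g u| `^ q)) expR);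
      last exact: continuous_expR.
    apply: cvgM; first exact: cvg_cst.
    apply: cvgB; first exact: cvg_cst.
    apply: (@continuous_comp _ _ _ g (fun x => `|x| `^ q)) => //; exact: cn.
  apply: cvgD; first exact: (cexp _ _ id cvg_id).
  apply: (cexp _ _ (fun u => t + s - u)).
  by apply: cvgB; [exact: cvg_cst|exact: cvg_id].
have der u : u \in `]0, t[ -> 0 < u < t + s.
  by rewrite in_itv/= => /andP[-> ut]; rewrite (lt_trans ut)// ltrDl.
apply: (@ger0_derive1_le_cc R (separation t s) 0 t).
- by move=> u /der/andP[u0 uD]; have [] := is_derive_separation u0 uD.
- move=> u ut; have /andP[u0 uD] := der _ ut.
  rewrite derive1E; have [_ ->] := is_derive_separation u0 uD.
  have {}ut : u <= t by move: ut; rewrite in_itv/= => /andP[_ /ltW].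
  rewrite mulr_ge0 ?subr_ge0//.
    by rewrite mulr_ge0// ltW// (lt_trans ltr01).
  have Du0 : 0 < t + s - u by rewrite subr_gt0.
  have pE w : 0 < w -> w `^ (q - 1) = expR ((q - 1) * ln w).
    by move=> w0; rewrite /powR gt_eqF.
  (* After taking logarithms, the sign of the derivative is exactly the comparison of slopes. *)
  rewrite !pE// -!expRD ler_expR.
  have := slope_diff_ndecr u0 ut s0 tsB; rewrite /slope; lra.
- exact: cont.
- by rewrite in_itv/= v0.
- by rewrite in_itv/= lexx (ltW t0).
- exact: vt.
Qed.

(* The weights [s `^ (q - 1)] and [t `^ (q - 1)] make [v = t] a critical point
   of the left-hand side. *)
Lemma powR_separation t s v : 0 < t -> 0 < s -> t + s <= 2 * B ->
  s `^ (q - 1) * expR (eta * (t `^ q - `|v| `^ q)) +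
  t `^ (q - 1) * expR (eta * (s `^ q - `|t + s - v| `^ q))
    <= s `^ (q - 1) + t `^ (q - 1).
Proof.
move=> t0 s0 tsB; have q0 := lt_trans ltr01 q_gt1.
(* The reflection of v into t + s - v exchanges the roles of t and s. *)
wlog vt : t s v t0 s0 tsB / v <= t => [H|].
  have [/H|tv] := leP v t; first exact.
  have vs : t + s - v <= s by rewrite lerBlDr addrC lerD2l ltW.
  have := H s t (t + s - v) s0 t0; rewrite [s + t]addrC subKr => /(_ tsB vs).
  by rewrite addrC [leRHS]addrC.
have [v0|v0] := leP 0 v.
  rewrite !ger0_norm//; last lra.
  by apply: separation_half; rewrite ?v0.
(* For v < 0 both |v| and t + s - v exceed their values at v = 0, so both exponentials are smaller
   there. *)
apply: le_trans (separation_half t0 s0 tsB (v := 0) _); last first.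
  by rewrite lexx ltW.
have le_pow (a b c : R) : 0 <= a -> a <= b ->
    expR (eta * (c - b `^ q)) <= expR (eta * (c - a `^ q)).
  move=> a0 ab; rewrite ler_expR ler_wpM2l ?(ltW eta_gt0)// lerB//.
  by rewrite ge0_ler_powR ?(ltW q0) ?nnegrE// (le_trans a0).
apply: lerD; rewrite ler_wpM2l ?powR_ge0//; apply: le_pow => //.
- by rewrite subr0 addr_ge0// ltW.
- by rewrite ger0_norm; lra.
Qed.

End KeyInequality.

Lemma dist_outputs (R : realType) (B y z : R) :
  outputs B y -> outputs B z -> `|y - z| <= 2 * B.
Proof.
rewrite /outputs /= !in_itv/= => /andP[? ?] /andP[? ?].
by rewrite ler_norml; apply/andP; split; lra.
Qed.

(** * The mixture risk at a fixed input, as a function of the output *)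

Section MixRisk.
Context {R : realType} {d : measure_display} {T : measurableType d}.
Variables (P : probability T R) (G : set T) (q B eta : R).
Variable U : T -> R.
Implicit Types y : R.

(** [U g] stands for the value g x at the fixed input x. *)
Definition weight y (g : T) : R := expR (- (eta * `|y - U g| `^ q)).

Definition mixture y : R := \int[P]_(g in G) weight y g.

Definition mix_risk y : R := - eta^-1 * ln (mixture y).

Hypotheses (mG : measurable G) (PG1 : P G = 1%E).
Hypotheses (q_gt1 : 1 < q) (B_gt0 : 0 < B) (eta_gt0 : 0 < eta).
Hypothesis eta_le :
  eta <= (q - 1) / (q * B `^ q) * Num.min 1 (2 `^ (2 - q)).
Hypotheses (mU : measurable_fun G U) (UB : forall g, G g -> outputs B (U g)).
Let q_gt0 : 0 < q := lt_trans ltr01 q_gt1.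


Let weight_le1 y g : weight y g <= 1.
Proof.
by rewrite /weight -expR0 ler_expR oppr_le0 mulr_ge0 ?powR_ge0// ltW.
Qed.

Let integrable_weight y : P.-integrable G (EFin \o weight y).
Proof.
apply: measurable_bounded_integrable => //.
- by rewrite [X in (X < _)%E]PG1 ltry.
- rewrite /weight; apply: measurableT_comp => //.
  apply: measurableT_comp => //; apply: measurable_funM => //.
  apply: (measurableT_comp (measurable_powR q)).
  by apply: measurableT_comp => //; exact: measurable_funB.
- exists 1; split=> // M M1 g _; rewrite /= ger0_norm ?expR_ge0//.
  exact: le_trans (weight_le1 _ _) (ltW M1).
Qed.

Let integrable_cst_G c : P.-integrable G (EFin \o cst c).
Proof.
apply: measurable_bounded_integrable => //.
  by rewrite [X in (X < _)%E]PG1 ltry.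
by exists `|c|; split=> // M M1 g _; exact: ltW.
Qed.

Let Rintegral_cst_G c : \int[P]_(g in G) cst c g = c.
Proof. by rewrite Rintegral_cst// [X in fine X]PG1 mulr1. Qed.

Let mixture_le1 y : mixture y <= 1.
Proof. by rewrite -[leRHS](Rintegral_cst_G 1); exact: le_Rintegral. Qed.

Let le_weight y g : outputs B y -> G g ->
  expR (- (eta * (2 * B) `^ q)) <= weight y g.
Proof.
move=> By Gg; rewrite /weight ler_expR lerN2 ler_pM2l//.
rewrite ge0_ler_powR ?nnegrE ?(ltW q_gt0)//.
- by rewrite mulr_ge0// ltW.
- by apply: dist_outputs => //; exact: UB.
Qed.

Let le_mixture y : outputs B y -> expR (- (eta * (2 * B) `^ q)) <= mixture y.
Proof.
move=> By; set c := expR _.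
apply: (@le_trans _ _ (\int[P]_(g in G) cst c g)).
  by rewrite Rintegral_cst_G.
apply: (le_Rintegral mG (integrable_cst_G c) (integrable_weight y)) => g.
exact: le_weight.
Qed.

Let mixture_gt0 y : outputs B y -> 0 < mixture y.
Proof. by move=> /le_mixture; apply: lt_le_trans; exact: expR_gt0. Qed.

(** Positivity of the mixture makes [ln] invertible here; bounds on the risk thus become bounds on
    the mixture. *)
Let mixtureE y : outputs B y -> mixture y = expR (- (eta * mix_risk y)).
Proof.
move=> By; rewrite /mix_risk mulrA mulrN divff ?gt_eqF// mulN1r opprK lnK//.
by rewrite posrE mixture_gt0.
Qed.

Lemma mix_risk_ge0 y : outputs B y -> 0 <= mix_risk y.
Proof.
move=> By; have := mixture_le1 y.
by rewrite mixtureE// -{1}expR0 ler_expR oppr_le0 pmulr_rge0.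
Qed.

Lemma mix_risk_le y : outputs B y -> mix_risk y <= (2 * B) `^ q.
Proof.
by move=> By; have := le_mixture By; rewrite mixtureE// ler_expR lerN2 ler_pM2l.
Qed.

(** The loss is Lipschitz in the output uniformly in g, so the weight at z is at least e^(-eta K)
    times the weight at y; this is then integrated. *)
Lemma mix_risk_lipschitz y z : outputs B y -> outputs B z ->
  mix_risk z <= mix_risk y + q * (2 * B) `^ (q - 1) * `|z - y|.
Proof.
move=> By Bz; set K := _ * `|z - y|.
rewrite -(ler_pM2l eta_gt0) -lerN2 -ler_expR -mixtureE// mulrDr opprD expRD.
rewrite -mixtureE// mulrC -RintegralZl//; apply: le_Rintegral => //.
  have := integrableZl mG (expR (- (eta * K))) (integrable_weight y).
  exact: eq_integrable.
move=> g Gg; rewrite /weight -expRD ler_expR -opprD lerN2 -mulrDr ler_pM2l//.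
have := @powR_lipschitz R q (2 * B) `|z - U g| `|y - U g| q_gt1.
have Ug := UB Gg; rewrite !normr_ge0 !dist_outputs// => /(_ isT isT) H.
have {}H := le_trans (ler_norm _) H.
rewrite -lerBlDr; apply: le_trans H _; rewrite ler_pM2l; last first.
  by rewrite mulr_gt0// powR_gt0// mulr_gt0.
by apply: le_trans (ler_dist_dist _ _) _; rewrite opprB addrA subrK.
Qed.

(** [powR_separation] at v = U g - y, for which t + s - v = z - U g, integrated over the set [G] of
    mass one. *)
Let mixture_separation t s y z : 0 < t -> 0 < s ->
  t + s = z - y -> t + s <= 2 * B ->
  s `^ (q - 1) * expR (eta * t `^ q) * mixture y +
  t `^ (q - 1) * expR (eta * s `^ q) * mixture z <= s `^ (q - 1) + t `^ (q - 1).
Proof.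
move=> t0 s0 ts tsB.
set a := _ * expR _; set b := _ * expR _; set c := (X in _ <= X).
have intZ r w : P.-integrable G (EFin \o (fun g => r * weight w g)).
  exact: eq_integrable mG _ _ _ (integrableZl mG r (integrable_weight w)).
have -> : a * mixture y + b * mixture z =
    \int[P]_(g in G) (a * weight y g + b * weight z g).
  rewrite (RintegralD mG (intZ a y) (intZ b z)).
  rewrite (RintegralZl a mG (integrable_weight y)).
  by rewrite (RintegralZl b mG (integrable_weight z)).
apply: (@le_trans _ _ (\int[P]_(g in G) cst c g)).
  2: by rewrite Rintegral_cst_G.
apply: (le_Rintegral mG _ (integrable_cst_G c)).
  exact: eq_integrable mG _ _ _ (integrableD mG (intZ a y) (intZ b z)).
have expE (r u v : R) :
    r * expR (eta * u) * expR (- (eta * v)) = r * expR (eta * (u - v)).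
  by rewrite -mulrA -expRD -mulrBr.
move=> g Gg; rewrite /a /b /c /weight !expE.
have -> : `|y - U g| = `|U g - y| by exact: distrC.
have -> : z - U g = t + s - (U g - y) by rewrite ts opprB addrA subrK.
apply: (powR_separation q_gt1 eta_gt0 _ (U g - y) t0 s0 tsB) => v w.
exact: powR_pair_rate q_gt1 B_gt0 eta_le.
Qed.

Lemma mix_risk_radii y z : outputs B y -> outputs B z ->
  z - y <= mix_risk y `^ q^-1 + mix_risk z `^ q^-1.
Proof.
move=> By Bz; rewrite leNgt; apply/negP => lt_radii.
(* Half the gap: adding it to each radius makes t and s exceed the radii strictly while t + s is
   exactly z - y. *)
pose e := (z - y - (mix_risk y `^ q^-1 + mix_risk z `^ q^-1)) / 2.
have e0 : 0 < e by rewrite divr_gt0// subr_gt0.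
pose t := mix_risk y `^ q^-1 + e; pose s := mix_risk z `^ q^-1 + e.
have t0 : 0 < t by rewrite ltr_wpDl// powR_ge0.
have s0 : 0 < s by rewrite ltr_wpDl// powR_ge0.
have ts : t + s = z - y by rewrite /t /s addrACA -splitr addrC subrK.
have tsB : t + s <= 2 * B.
  by rewrite ts (le_trans (ler_norm _))// dist_outputs.
have radius w a : outputs B w -> mix_risk w `^ q^-1 < a ->
    expR (- (eta * a `^ q)) < mixture w.
  move=> Bw aw; rewrite mixtureE// ltr_expR ltrN2 ltr_pM2l//.
  rewrite -{1}[mix_risk w]powRr1 ?mix_risk_ge0//.
  rewrite -(mulVf (lt0r_neq0 q_gt0)) powRrM.
  apply: gt0_ltr_powR; rewrite ?nnegrE ?powR_ge0//.
  by rewrite (le_trans _ (ltW aw))// powR_ge0.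
have := radius y t By; rewrite ltrDl => /(_ e0) lt_y.
have := radius z s Bz; rewrite ltrDl => /(_ e0) lt_z.
move: (mixture_separation t0 s0 ts tsB); clearbody t s.
move: (mixture y) (mixture z) lt_y lt_z => i j lt_i lt_j.
apply/negP; rewrite -ltNge.
have a0 : 0 < s `^ (q - 1) * expR (eta * t `^ q).
  by rewrite mulr_gt0 ?powR_gt0 ?expR_gt0.
have b0 : 0 < t `^ (q - 1) * expR (eta * s `^ q).
  by rewrite mulr_gt0 ?powR_gt0 ?expR_gt0.
(* The right-hand side is the same combination with the mixtures replaced by their strict lower
   bounds e^(-eta t^q) and e^(-eta s^q), which gives the contradiction. *)
have -> : s `^ (q - 1) + t `^ (q - 1) =
    s `^ (q - 1) * expR (eta * t `^ q) * expR (- (eta * t `^ q)) +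
    t `^ (q - 1) * expR (eta * s `^ q) * expR (- (eta * s `^ q)).
  by rewrite -!mulrA -!expRD !subrr expR0 !mulr1.
by apply: ltrD; rewrite ltr_pM2l.
Qed.

End MixRisk.

(** * A common point of intervals, and a dense sequence of outputs *)

Section CenterOfIntervals.
Context {R : realType}.
Implicit Types y r : R^nat.

Lemma sups0E (u : R^nat) : sups u 0 = sup (range u).
Proof.
by congr sup; apply/seteqP; split=> [_ [n _ <-]|_ [n _ <-]]; exists n.
Qed.

(* Helly's theorem on the line, with an explicit common point. *)
Lemma sup_in_all_intervals y r n :
  (forall i j, y i - r i <= y j + r j) ->
  `|y n - sup (range (fun i => y i - r i))| <= r n.
Proof.
move=> yr; have ub j : ubound (range (fun i => y i - r i)) (y j + r j).
  by move=> _ [i _ <-].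
have n0 : range (fun i => y i - r i) !=set0 by exists (y 0 - r 0), 0.
rewrite ler_distl lerBlDr; apply/andP; split; first exact: ge_sup.
by rewrite -lerBlDr; apply: ub_le_sup; [exists (y n + r n)|exists n].
Qed.

(** The rationals clamped to [-B, B], enumerated through their codes; a number that codes no
    rational is sent to the clamped value of 0. *)
Definition rational_outputs (B : R) : R^nat := fun n =>
  Num.max (- B) (Num.min B (ratr (odflt 0 (unpickle n : option rat)))).

Lemma rational_outputsP (B : R) n : 0 < B -> outputs B (rational_outputs B n).
Proof.
by move=> B0; rewrite /outputs/= in_itv/= /rational_outputs le_max lexx/=
  ge_max ge_min lexx andbT ge0_cp ?ltW.
Qed.

(** A rational is taken in ]z, z + e[; clamping does not move it away from z, which already lies in
    [-B, B]. *)
Lemma dense_rational_outputs (B : R) (z e : R) : outputs B z -> 0 < e ->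
  exists n, `|rational_outputs B n - z| <= e.
Proof.
rewrite /outputs/= in_itv/= => /andP[zB Bz] e0.
have /rat_in_itvoo[a] : z < z + e by rewrite ltrDl.
rewrite in_itv/= => /andP[za ae]; exists (pickle a).
rewrite /rational_outputs pickleK/= ler_distl maxEle minEle.
move: (ratr a : R) za ae => b zb be {a}.
by case: (leP B b) => Bb; [case: (leP (- B) B)|case: (leP (- B) b)] => Bb';
  apply/andP; split; lra.
Qed.

End CenterOfIntervals.

(** Tonelli's theorem: a partial integral of a nonnegative jointly measurable function is
    measurable. The integrand is extended by 0 outside X x G, since evaluation is only assumed
    measurable on that product. *)
Lemma measurable_mixture (R : realType) dX (X : measurableType dX) (q eta : R)
    (S : set (set (X -> R))) (G : set (X -> R))
    (rho : probability (g_sigma_algebraType S) R) (y : R) :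
  S.-sigma.-measurable G -> jointly_measurable S G ->
  measurable_fun setT (fun x => mixture rho G q eta (fun g => g x) y).
Proof.
move=> mG hev.
pose h (p : X * g_sigma_algebraType S) := expR (- (eta * `|y - p.2 p.1| `^ q)).
pose D : set (X * g_sigma_algebraType S) := [set: X] `*` G.
have mD : measurable D by exact: measurableX.
have mh : measurable_fun D h.
  apply: measurableT_comp => //; apply: measurableT_comp => //.
  apply: measurable_funM => //; apply: (measurableT_comp (measurable_powR q)).
  by apply: measurableT_comp => //; exact: measurable_funB.
have mhD : measurable_fun setT (EFin \o (h \_ D)).
  by apply/measurable_EFinP; apply/(measurable_restrictT h mD).
have hD0 p : (0 <= (EFin \o (h \_ D)) p)%E.
  by rewrite /= lee_fin patchE; case: ifP => // _; exact: expR_ge0.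
have mF := measurable_fun_fubini_tonelli_F (m2 := rho) (EFin \o (h \_ D)) mhD hD0.
rewrite (_ : (fun x => _) = fine \o fubini_F rho (EFin \o (h \_ D))).
  exact: measurableT_comp.
apply/funext => x; rewrite /mixture Rintegral_mkcond/=; congr fine.
apply: eq_integral => g _; rewrite /= !patchE; congr EFin.
have -> // : ((x, g) \in D) = (g \in G).
by apply/idP/idP => /set_mem; [case=> _ /mem_set|move=> Gg; apply/mem_set].
Qed.

(** * Construction of the predictor: its range, its measurability and its loss *)

Theorem corollary4p5 (R : realType) (dX : measure_display)
    (X : measurableType dX) (q B : R) (hq : 1 < q) (hB : 0 < B)
    (S : set (set (X -> R))) (G : set (X -> R))
    (mG : S.-sigma.-measurable G)
    (hG : G `<=` prediction_functions B)
    (hev : jointly_measurable S G)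
    (eta : R) (eta_gt0 : 0 < eta)
    (heta : eta <= (q - 1) / (q * B `^ q) * Num.min 1 (2 `^ (2 - q)))
    (rho : probability (g_sigma_algebraType S) R) (hrho : rho G = 1%E) :
  exists2 g_rho : X -> R, prediction_functions B g_rho &
    forall (x : X) (y : R), outputs B y ->
      Lq_loss q (x, y) g_rho <= mix_loss G rho eta (Lq_loss q) (x, y).
Proof.
have q0 : 0 < q := lt_trans ltr01 hq.
pose ev (x : X) (g : g_sigma_algebraType S) : R := g x.
have mev x : measurable_fun (G : set (g_sigma_algebraType S)) (ev x).
  apply: (measurable_comp _ _ hev (g := pair x)) => //.
  - exact: measurableX.
  - by move=> _ [g Gg <-].
  - exact/measurable_funTS/pair1_measurable.
have evB x g : G g -> outputs B (ev x g) by move=> /hG[_ /(_ x)].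
pose risk x y := mix_risk rho G q eta (ev x) y.
pose yn := rational_outputs B; have ynB n : outputs B (yn n).
  exact: rational_outputsP.
pose r x n := risk x (yn n) `^ q^-1.
pose g_rho x := sup (range (fun n => yn n - r x n)).
have risk_ge0 x y : outputs B y -> 0 <= risk x y.
  by move=> By; exact: (mix_risk_ge0 mG hrho hq hB eta_gt0 (mev x) (evB x)).
have radii x i j : yn i - r x i <= yn j + r x j.
  rewrite lerBlDr -addrA -lerBlDl.
  exact: (mix_risk_radii mG hrho hq hB eta_gt0 heta (mev x) (evB x)).
have g_rho_dist x n : `|yn n - g_rho x| <= r x n.
  exact: sup_in_all_intervals.
have ubB x : ubound (range (fun n => yn n - r x n)) B.
  move=> _ [n _ <-]; rewrite lerBlDr.
  have := ynB n; rewrite /outputs/= in_itv/= => /andP[_ ynB'].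
  by rewrite (le_trans ynB')// lerDl powR_ge0.
have BB : outputs B B by rewrite /outputs/= in_itv/= lexx andbT; lra.
have r_le x n : r x n <= 2 * B.
  have B20 : 0 <= 2 * B by rewrite mulr_ge0// ltW.
  have -> : 2 * B = ((2 * B) `^ q) `^ q^-1.
    by rewrite -powRrM divff ?lt0r_neq0// powRr1.
  rewrite ge0_ler_powR ?nnegrE ?powR_ge0 ?risk_ge0 ?invr_ge0 ?(ltW q0)//.
  exact: (mix_risk_le mG hrho hq hB eta_gt0 (mev x) (evB x) (ynB n)).
have g_rhoB x : outputs B (g_rho x).
  rewrite /outputs/= in_itv/=; apply/andP; split; last first.
    by apply: ge_sup => //; exists (yn 0 - r x 0), 0.
  apply/ler_addgt0Pr => e e0.
  (* Radii are at most 2B, so a center within e of B has its left endpoint at or above -B - e. *)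
  have [n] := dense_rational_outputs BB e0; rewrite ler_distl => /andP[Bn _].
  have := g_rho_dist x n; rewrite ler_distl => /andP[_].
  by have := r_le x n; rewrite -/yn in Bn *; lra.
exists g_rho.
  split=> //.
  (* Written as a tail supremum from index 0, the predictor is a countable supremum of measurable
     functions of x. *)
  rewrite (_ : g_rho = fun x => sups (fun n => yn n - r x n) 0); last first.
    by apply/funext => x; rewrite sups0E.
  apply: (measurable_fun_sups (h := fun n x => yn n - r x n)) => // n.
    by exists B; exact: ubB.
  apply: measurable_funB => //.
  apply: (measurableT_comp (measurable_powR _)).
  apply: measurable_funM => //; apply: measurableT_comp => //.
  exact: measurable_mixture.
move=> x y By; rewrite /Lq_loss/= -[leRHS]/(risk x y).
pose K := q * (2 * B) `^ (q - 1).
have K0 : 0 < K by rewrite mulr_gt0// powR_gt0// mulr_gt0.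
apply/ler_addgt0Pr => e e0.
(* Passing from y to a nearby term of the sequence costs K times their distance twice, once for the
   loss and once for the risk; each cost is at most e / 2. *)
have e'0 : 0 < e / (2 * K) by rewrite divr_gt0// mulr_gt0.
have [n yny] := dense_rational_outputs By e'0.
have lip := mix_risk_lipschitz mG hrho hq hB eta_gt0 (mev x) (evB x) By (ynB n).
have := @powR_lipschitz R q (2 * B) `|y - g_rho x| `|yn n - g_rho x| hq.
rewrite !normr_ge0 !dist_outputs// => /(_ isT isT) /(le_trans (ler_norm _)) lip'.
have near_n : `|yn n - g_rho x| `^ q <= risk x (yn n).
  rewrite -[leRHS]powRr1 ?risk_ge0// -(mulVf (lt0r_neq0 q0)) powRrM.
  by rewrite ge0_ler_powR ?nnegrE ?powR_ge0 ?(ltW q0)// g_rho_dist.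
have dist_le : `| `|y - g_rho x| - `|yn n - g_rho x| | <= `|yn n - y|.
  by rewrite [leRHS]distrC (le_trans (ler_dist_dist _ _))// opprB addrA subrK.
move: lip lip' near_n; rewrite -/(risk x y) -/(risk x (yn n)) -/K.
have := ler_wpM2l (ltW K0) dist_le.
have := ler_wpM2l (ltW K0) yny.
have -> : K * (e / (2 * K)) = e / 2 by field; rewrite gt_eqF.
move: (risk x y) (risk x (yn n)) (K * _) (K * _) => a b c c'.
move: (`|y - _| `^ q) (`|yn n - _| `^ q) => u v; clear; lra.
Qed.
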